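(* Let $D$ be a finite simple digraph of order $n\geq 3$ whose underlying graph $G[D]$ is connected. Then $b_I(D) \leq (\gamma_I(D)-1)\Delta(G[D])$.
   Context: A finite simple digraph has no loops and no multiple arcs (oppositely oriented arcs allowed). The underlying graph $G[D]$ is the multigraph obtained by replacing each arc $uv$ by an edge $uv$ (two parallel edges when both $uv,vu\in A(D)$); $\Delta(G[D])$ is its maximum degree. An Italian dominating function (IDF) on $D$ is a function $f:V(D)\to\{0,1,2\}$ such that every vertex $v$ with $f(v)=0$ has at least two in-neighbors $w$ with $f(w)=1$ or at least one in-neighbor $w$ with $f(w)=2$; its weight is $\sum_u f(u)$ and $\gamma_I(D)$ is the minimum weight of an IDF. The Italian bondage number $b_I(D)$ is the minimum number of arcs of $A(D)$ whose removal from $D$ (keeping all vertices) results in a digraph $D'$ with $\gamma_I(D')>\gamma_I(D)$.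
   Formalization: The bound is stated only for digraphs D in which removing some set of arcs increases the Italian domination number; otherwise (γ_I(D) = n, e.g. the directed path on three vertices) b_I(D) is undefined. *)

(* Defs.v *)
From mathcomp Require Import all_boot.

Set Implicit Arguments.
Unset Strict Implicit.
Unset Printing Implicit Defensive.

(* A finite digraph without multiple arcs on the vertex set T is given by its
   set of arcs A : {set T * T}, where (u, v) is the arc from u to v.
   Removing a set B of arcs (keeping all vertices) gives A :\: B. *)

Section ItalianDomination.
Variable T : finType.
Implicit Types (A B : {set T * T}) (f : {ffun T -> 'I_3}) (u v w : T).

Definition loopless A := [forall v, (v, v) \notin A].

Definition underlying_adj A : rel T :=
  [rel u v | ((u, v) \in A) || ((v, u) \in A)].

Definition underlying_connected A :=
  [forall u, forall v, connect (underlying_adj A) u v].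

(* Each arc contributes one edge to the underlying multigraph, so a pair of
   opposite arcs between v and w counts twice in the degree of v. *)
Definition underlying_degree A v :=
  #|[set a in A | (a.1 == v) || (a.2 == v)]|.

Definition underlying_max_degree A := \max_(v : T) underlying_degree A v.

Definition italian_dominating A f :=
  [forall v, (f v == 0 :> nat) ==>
     (2 <= #|[set w | ((w, v) \in A) && (f w == 1 :> nat)]|)
     || [exists w, ((w, v) \in A) && (f w == 2 :> nat)]].

Definition weight f : nat := \sum_(v : T) f v.

Lemma italian_dominating_const2 A : italian_dominating A [ffun=> ord_max].
Proof. by apply/forallP => v; rewrite ffunE. Qed.

(* The constant function 2 is only the starting point of the minimisation; it
   is Italian dominating by the lemma above. *)
Definition italian_domination_number A : nat :=
  weight [arg min_(f < [ffun=> ord_max] | italian_dominating A f) weight f].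

Lemma italian_domination_numberP A :
  (exists2 f, italian_dominating A f & weight f = italian_domination_number A)
  /\ (forall f, italian_dominating A f ->
        italian_domination_number A <= weight f).
Proof.
rewrite /italian_domination_number.
case: arg_minnP => [|f Af minf]; first exact: italian_dominating_const2.
by split; first exists f.
Qed.

Definition italian_bondage_set A B :=
  (B \subset A) &&
  (italian_domination_number A < italian_domination_number (A :\: B)).

Definition italian_bondage_size A (k : nat) :=
  [exists B, italian_bondage_set A B && (#|B| == k)].

(* The minimum is over a nonempty set of sizes exactly when
   italian_domination_number A < #|T|: a digraph without arcs has number #|T|,
   and this is the largest possible value.  For instance the directed path on
   three vertices has number 3 and no bondage set.  The Italian bondage number
   therefore takes the existence of a bondage set as an argument. *)
Definition italian_bondage_number A
    (bondable : exists k, italian_bondage_size A k) : nat :=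
  ex_minn bondable.

End ItalianDomination.

(* Main.v *)
Require Import Defs.
From mathcomp Require Import all_boot.
From mathcomp Require Import zify.

(** Isolate any gamma - 1 vertices, by removing at most (gamma - 1) * Delta
    arcs.  Each isolated vertex must then have positive weight.  A bondage set
    exists only when gamma < n, so at least two vertices remain, and these
    carry weight at least 2: either they are all positive, or one of them has
    weight 0 and receives weight 2 from its in-neighbours, none of which is
    isolated.  The total is at least gamma + 1. *)

Section IsolatingVertices.
Variable T : finType.
Implicit Types (A : {set T * T}) (f : {ffun T -> 'I_3}) (S P : {set T}).

Lemma italian_domination_number_le_order A : italian_domination_number A <= #|T|.
Proof.
have [_ /(_ [ffun=> inord 1])] := italian_domination_numberP A.
rewrite /weight (eq_bigr (fun=> 1)) => [|v _]; last by rewrite ffunE inordK.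
rewrite sum1_card; apply; apply/forallP => v.
by rewrite ffunE inordK.
Qed.

(** Two in-neighbours of value 1 and one of value 2 both contribute 2. [P] is left free to serve
    twice: as the empty set, where the bound is absurd, and as the complement of the isolated
    set. *)
Lemma in_neighbour_weight A f v P :
    italian_dominating A f -> f v = 0 :> nat ->
    (forall w, (w, v) \in A -> w \in P) ->
  2 <= \sum_(w in P) f w.
Proof.
move=> /forallP/(_ v) domv fv0 subP; move: domv; rewrite fv0 eqxx /=.
case/orP => [two|/existsP[w /andP[/subP wP /eqP fw2]]]; last first.
  by rewrite (bigD1 w) //= fw2.
apply: leq_trans two _; rewrite -sum1_card big_mkcond [leqRHS]big_mkcond /=.
apply: leq_sum => w _; rewrite inE.
by case: andP => // -[/subP -> /eqP ->].
Qed.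

Definition incident_arcs A S := [set a in A | (a.1 \in S) || (a.2 \in S)].

(** The stars of the vertices of [S] cover these arcs; an arc joining two vertices of [S] lies in
    two stars, so the bound can be strict. *)
Lemma card_incident_arcs A S :
  #|incident_arcs A S| <= #|S| * underlying_max_degree A.
Proof.
pose E v := [set a in A | (a.1 == v) || (a.2 == v)].
apply: (@leq_trans (\sum_(v in S) #|E v|)); last first.
  rewrite -sum_nat_const; apply: leq_sum => v _.
  exact: (leq_bigmax_cond (F := underlying_degree A)).
have sub : incident_arcs A S \subset \bigcup_(v in S) E v.
  apply/subsetP => a; rewrite inE => /andP[aA /orP[] aS];
    by apply/bigcupP; eexists; first exact: aS; rewrite inE aA eqxx ?orbT.
apply: leq_trans (subset_leq_card sub) _.
elim/big_rec2: _ => [|v n U _ leUn]; first by rewrite cards0.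
by apply: leq_trans (leq_card_setU _ _) _; rewrite leq_add2l.
Qed.

Lemma weight_without_incident_arcs A S f :
    2 <= #|~: S| -> italian_dominating (A :\: incident_arcs A S) f ->
  #|S| + 2 <= weight f.
Proof.
move=> restS domf.
have arcC u v : (u, v) \in A :\: incident_arcs A S -> (u \notin S) && (v \notin S).
  by rewrite !inE /= => /andP[+ uvA]; rewrite uvA negb_or.
have posS v : v \in S -> 0 < f v.
  move=> vS; rewrite lt0n; apply/negP => /eqP fv0.
  (* No remaining arc enters [v], so its in-neighbours lie in the empty set. *)
  have : 2 <= \sum_(w in set0) f w.
    by apply: in_neighbour_weight domf fv0 _ => w /arcC; rewrite vS andbF.
  by rewrite big_set0.
rewrite /weight (bigID (mem S)) /=; apply: leq_add.
  by rewrite -sum1_card; apply: leq_sum => v /posS.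
rewrite (eq_bigl (mem (~: S))) => [|v]; last by rewrite !inE.
case: (pickP [pred v in ~: S | f v == 0 :> nat]) => [v /andP[_ /eqP fv0]|pos].
  by apply: in_neighbour_weight domf fv0 _ => w /arcC /andP[]; rewrite inE.
apply: leq_trans restS _; rewrite -sum1_card; apply: leq_sum => v vS.
by move: (pos v); rewrite /= vS lt0n => /= ->.
Qed.

End IsolatingVertices.

Theorem theorem3p2 (T : finType) (A : {set T * T})
    (hloop : loopless A)
    (hn : 3 <= #|T|)
    (hconn : underlying_connected A)
    (hbond : exists k, italian_bondage_size A k) :
  italian_bondage_number hbond <=
    (italian_domination_number A - 1) * underlying_max_degree A.
Proof.
(* Removing a bondage set raises the domination number strictly, and the result is still at most the
   order. *)
have ltn_order : italian_domination_number A < #|T|.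
  have [k /existsP[B /andP[/andP[_ ltAB] _]]] := hbond.
  exact: leq_trans ltAB (italian_domination_number_le_order _ _).
have [S cardS] : exists S : {set T}, #|S| = italian_domination_number A - 1.
  exists [set v in take (italian_domination_number A - 1) (enum T)].
  have /card_uniqP := take_uniq (italian_domination_number A - 1) (enum_uniq T).
  by rewrite cardsE => ->; rewrite size_takel // -cardE (leq_trans (leq_subr _ _) (ltnW _)).
rewrite /italian_bondage_number; case: (ex_minnP hbond) => k _ mink.
(* By minimality of [k], it is enough that the arcs meeting [S] form a bondage set. *)
rewrite -cardS; apply: leq_trans (card_incident_arcs _ A S); apply: mink.
apply/existsP; exists (incident_arcs T A S); rewrite eqxx andbT.
apply/andP; split; first by apply/subsetP => a; rewrite inE => /andP[].
have [[f domf <-] _] := italian_domination_numberP (A :\: incident_arcs T A S).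
(* For a positive domination number this is [ltn_order]; at 0 the subtraction truncates, [S] is
   empty and [hn] gives the bound. *)
have : 2 <= #|~: S| by rewrite -(leq_add2l #|S|) cardsC cardS; lia.
by move=> /weight_without_incident_arcs/(_ domf); lia.
Qed.
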